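(* Let $G$ be a finite group acting on an idempotent complete extriangulated category $\mathcal{E}$ such that the equivariantization $\mathcal{E}^G$ carries a naturally induced extriangulated structure, the functors $Ind:\mathcal{E}\to\mathcal{E}^G$ and $\mathscr{F}:\mathcal{E}^G\to\mathcal{E}$ are exact and satisfy $Ind\dashv\mathscr{F}\dashv Ind$, and every object $(A,\varphi)\in\mathcal{E}^G$ is a direct summand of $Ind(A)$. Let $C$ be a subset of $as_G(\mathcal{E})$ and put $C^G:=\{\mathcal{I}^G:\mathcal{I}\in C\}$. Then: (1) For every object $E\in\mathcal{E}$ and every $\mathcal{I}\in C$: $\mathcal{I}\in supp_C(E)$ if and only if $\mathcal{I}^G\in supp_{C^G}(Ind(E))$. (2) For every object $(E,\varphi)\in\mathcal{E}^G$ and every $\mathcal{I}\in C$: $\mathcal{I}^G\in supp_{C^G}(E,\varphi)$ if and only if $\mathcal{I}\in supp_C(E)$. (3) Let $D$ be a subset of $as(\mathcal{E}^G)$ containing $C^G$. Then there is an immersion $$Esp_C(\mathcal{E})\cong Esp_{C^G}(\mathcal{E}^G)\hookrightarrow Esp_D(\mathcal{E}^G),$$ where the homeomorphism is $\mathcal{I}\mapsto\mathcal{I}^G$ and the second map is the inclusion. This immersion is a homeomorphism if and only if $D=C^G$.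
   Context: An action of $G$ (identity $e$) on $\mathcal{E}$ consists of exact equivalences $T_g:\mathcal{E}\to\mathcal{E}$ ($g\in G$; exact means additive and sending conflations to conflations) and natural isomorphisms $\gamma_{g,h}:T_gT_h\to T_{gh}$ with $\gamma_{g,hk}\circ T_g\gamma_{h,k}=\gamma_{gh,k}\circ\gamma_{g,h}T_k$ for all $g,h,k$. A $G$-equivariant object is a pair $(E,\varphi)$ with $E\in\mathcal{E}$ and isomorphisms $\varphi_g:T_gE\to E$ such that $\varphi_{gh}\circ\gamma_{g,h}^E=\varphi_g\circ T_g\varphi_h$. The equivariantization $\mathcal{E}^G$ has these as objects and, as morphisms, the morphisms in $\mathcal{E}$ commuting with the $\varphi_g$'s. $\mathscr{F}(E,\varphi)=E$ is the forgetful functor and $Ind(A)=(\bigoplus_{g}T_gA,\tau^A)$ with $\tau^A_h=\bigoplus_g\gamma^A_{h,h^{-1}g}$. For an extriangulated category $\mathcal{E}'$, $as(\mathcal{E}')$ is the collection of non-empty full subcategories closed under finite direct sums and direct summands. A subcategory $\mathcal{N}$ of $\mathcal{E}$ is $G$-invariant if $T_g(\mathcal{N})\subseteq\mathcal{N}$ for all $g\in G$; $as_G(\mathcal{E})$ is the collection of $G$-invariant members of $as(\mathcal{E})$. For $\mathcal{I}\in as(\mathcal{E})$, $\mathcal{I}^G:=\{(E,\varphi)\in\mathcal{E}^G: E\in\mathcal{I}\}$, which lies in $as(\mathcal{E}^G)$. For $C\subseteq as(\mathcal{E}')$, $Esp_C(\mathcal{E}')$ is the set $C$ with the topology whose closed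 sets are $\{\mathcal{P}\in C:\mathcal{P}\cap\mathcal{X}=\emptyset\}$, $\mathcal{X}$ ranging over classes of objects of $\mathcal{E}'$; $supp_C(E):=\{\mathcal{P}\in C:E\notin\mathcal{P}\}$. An immersion is a homeomorphism onto its image with the subspace topology. *)

(* Defs.v *)
From HB Require Import structures.
From mathcomp Require Import all_boot all_order all_algebra all_fingroup.
From mathcomp Require Import all_classical.
From mathcomp Require Import topology.

Set Implicit Arguments.
Unset Strict Implicit.
Unset Printing Implicit Defensive.

Import GRing.Theory.
Local Open Scope classical_set_scope.
Local Open Scope ring_scope.

Local Obligation Tactic := idtac.

Reserved Notation "g \oc f" (at level 40, left associativity).

Record preadditive_cat := Preadditive {
  obj :> Type ;
  hom : obj -> obj -> zmodType ;
  idm : forall X, hom X X ;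
  comp : forall X Y Z, hom Y Z -> hom X Y -> hom X Z ;
  comp1m : forall X Y (f : hom X Y), comp (idm Y) f = f ;
  compm1 : forall X Y (f : hom X Y), comp f (idm X) = f ;
  compA : forall W X Y Z (h : hom Y Z) (g : hom X Y) (f : hom W X),
    comp h (comp g f) = comp (comp h g) f ;
  compDl : forall X Y Z (g g' : hom Y Z) (f : hom X Y),
    comp (g + g') f = comp g f + comp g' f ;
  compDr : forall X Y Z (g : hom Y Z) (f f' : hom X Y),
    comp g (f + f') = comp g f + comp g f' }.

Arguments hom {p} _ _.
Arguments idm {p} X.
Arguments comp {p X Y Z} _ _.
Notation "g \oc f" := (comp g f).

Definition is_iso (A : preadditive_cat) (X Y : A) (f : hom X Y) : Prop :=
  exists g : hom Y X, g \oc f = idm X /\ f \oc g = idm Y.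

Record is_dsum (A : preadditive_cat) (I : finType) (X : I -> A) (S : A)
    (inj : forall i, hom (X i) S) (prj : forall i, hom S (X i)) : Prop := IsDsum {
  dsum_id : forall i, prj i \oc inj i = idm (X i) ;
  dsum_0 : forall i j, i != j -> prj j \oc inj i = 0 ;
  dsum_sum : \sum_i inj i \oc prj i = idm S }.

Record dsum (A : preadditive_cat) (I : finType) (X : I -> A) := Dsum {
  dsum_obj :> A ;
  inj : forall i, hom (X i) dsum_obj ;
  prj : forall i, hom dsum_obj (X i) ;
  dsumP : is_dsum inj prj }.

Arguments inj {A I X} d i.
Arguments prj {A I X} d i.

Record is_dsum2 (A : preadditive_cat) (X Y S : A)
    (iX : hom X S) (iY : hom Y S) (pX : hom S X) (pY : hom S Y) : Prop := IsDsum2 {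
  dsum2_XX : pX \oc iX = idm X ;
  dsum2_YY : pY \oc iY = idm Y ;
  dsum2_XY : pX \oc iY = 0 ;
  dsum2_YX : pY \oc iX = 0 ;
  dsum2_sum : iX \oc pX + iY \oc pY = idm S }.

Definition direct_summand (A : preadditive_cat) (X S : A) : Prop :=
  exists (Y : A) (iX : hom X S) (iY : hom Y S) (pX : hom S X) (pY : hom S Y),
    is_dsum2 iX iY pX pY.

(* The case of an empty I gives the zero object. *)
Record additive_cat := Additive {
  additive_pre :> preadditive_cat ;
  dsum_ex : forall (I : finType) (X : I -> additive_pre), $| dsum X | }.

Definition bigdsum (A : additive_cat) (I : finType) (X : I -> A) : dsum X :=
  unsquash (dsum_ex X).

Definition idempotent_complete (A : preadditive_cat) : Prop :=
  forall (X : A) (e : hom X X), e \oc e = e ->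
    exists (Y : A) (r : hom X Y) (s : hom Y X), r \oc s = idm Y /\ s \oc r = e.

Section PreadditiveTheory.
Variable A : preadditive_cat.
Implicit Types X Y Z : A.

Lemma comp0m X Y Z (f : hom X Y) : (0 : hom Y Z) \oc f = 0.
Proof. by apply: (addrI ((0 : hom Y Z) \oc f)); rewrite -compDl !addr0. Qed.

Lemma compm0 X Y Z (g : hom Y Z) : g \oc (0 : hom X Y) = 0.
Proof. by apply: (addrI (g \oc (0 : hom X Y))); rewrite -compDr !addr0. Qed.

Lemma compNl X Y Z (g : hom Y Z) (f : hom X Y) : (- g) \oc f = - (g \oc f).
Proof. by apply/eqP; rewrite -addr_eq0 -compDl addNr comp0m. Qed.

Lemma compNr X Y Z (g : hom Y Z) (f : hom X Y) : g \oc (- f) = - (g \oc f).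
Proof. by apply/eqP; rewrite -addr_eq0 -compDr addNr compm0. Qed.

Lemma comp_suml X Y Z (I : finType) (g : I -> hom Y Z) (f : hom X Y) :
  (\sum_i g i) \oc f = \sum_i g i \oc f.
Proof.
by apply: (big_morph (fun g => g \oc f)) => [? ?|]; rewrite ?compDl ?comp0m.
Qed.

Lemma comp_sumr X Y Z (I : finType) (g : hom Y Z) (f : I -> hom X Y) :
  g \oc (\sum_i f i) = \sum_i g \oc f i.
Proof. by apply: big_morph => [? ?|]; rewrite ?compDr ?compm0. Qed.

Lemma is_dsum2P X Y S (iX : hom X S) (iY : hom Y S) pX pY :
  let XY b := if b then X else Y in
  is_dsum2 iX iY pX pY <->
  @is_dsum A bool XY S
    (fun b => if b return hom (XY b) S then iX else iY)
    (fun b => if b return hom S (XY b) then pX else pY).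
Proof.
split=> [[? ? ? ? e]|[h1 h0 hs]].
  by split=> [[]|[] []|] //; rewrite big_bool.
split; first exact: (h1 true).
- exact: (h1 false).
- exact: (h0 false true).
- exact: (h0 true false).
- by rewrite -hs big_bool.
Qed.

End PreadditiveTheory.

Lemma dsum2_ex (A : additive_cat) (X Y : A) :
  exists (S : A) (iX : hom X S) (iY : hom Y S) (pX : hom S X) (pY : hom S Y),
    is_dsum2 iX iY pX pY.
Proof.
have [S i p [h1 h0 hs]] := bigdsum (fun b : bool => if b then X else Y).
exists S, (i true), (i false), (p true), (p false).
split; first exact: (h1 true).
- exact: (h1 false).
- exact: (h0 false true).
- exact: (h0 true false).
- by rewrite -hs big_bool.
Qed.

Record functor (A B : preadditive_cat) := Functor {
  fobj :> A -> B ;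
  fmap : forall X Y : A, hom X Y -> hom (fobj X) (fobj Y) ;
  fmap1 : forall X, fmap (idm X) = idm (fobj X) ;
  fmapM : forall X Y Z (g : hom Y Z) (f : hom X Y),
    fmap (g \oc f) = fmap g \oc fmap f }.

Arguments fmap {A B} f0 {X Y} _.

Definition id_functor (A : preadditive_cat) : functor A A :=
  @Functor A A (fun X => X) (fun _ _ f => f) (fun _ => erefl)
    (fun _ _ _ _ _ => erefl).

Program Definition comp_functor (A B C : preadditive_cat)
    (F : functor B C) (F' : functor A B) : functor A C :=
  @Functor A C (fun X => F (F' X)) (fun _ _ f => fmap F (fmap F' f)) _ _.
Next Obligation. by move=> *; rewrite /= !fmap1. Qed.
Next Obligation. by move=> *; rewrite /= !fmapM. Qed.

Definition nat_iso (A B : preadditive_cat) (F F' : functor A B) : Prop :=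
  exists a : forall X, hom (F X) (F' X),
    (forall X Y (f : hom X Y), a Y \oc fmap F f = fmap F' f \oc a X) /\
    (forall X, is_iso (a X)).

Definition is_equivalence (A B : preadditive_cat) (F : functor A B) : Prop :=
  exists F' : functor B A,
    nat_iso (comp_functor F' F) (id_functor A) /\
    nat_iso (comp_functor F F') (id_functor B).

Definition adjoint (A B : preadditive_cat) (F : functor A B) (F' : functor B A) :
    Prop :=
  exists Phi : forall X Y, hom (F X) Y -> hom X (F' Y),
    (forall X Y, bijective (@Phi X Y)) /\
    (forall X X' Y Y' (u : hom X' X) (v : hom Y Y') (f : hom (F X) Y),
       Phi X' Y' (v \oc f \oc fmap F u) = fmap F' v \oc Phi X Y f \oc u).

Definition additive_functor (A B : preadditive_cat) (F : functor A B) : Prop :=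
  forall X Y (f f' : hom X Y), fmap F (f + f') = fmap F f + fmap F f'.

(* Two sequences X -> Y -> Z and X -> Y' -> Z are equivalent if they differ by
   an isomorphism of the middle terms. *)
Definition seq_equiv (A : preadditive_cat) (X Y Y' Z : A)
    (x : hom X Y) (y : hom Y Z) (x' : hom X Y') (y' : hom Y' Z) : Prop :=
  exists b : hom Y Y', [/\ is_iso b, b \oc x = x' & y' \oc b = y].

(* Extriangulated structures in the sense of Nakaoka and Palu: [pull1] to
   [push_pull] are (ET1), [realizes_ex] to [realizes_dsum] are (ET2).
   [ext Z X] is the group E(Z,X) of extensions, contravariant in Z through
   [pull] and covariant in X through [push]; [realizes d x y] means that the
   sequence X -x-> Y -y-> Z belongs to the equivalence class s(d). *)
Record extriangulation (A : additive_cat) := Extriangulation {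
  ext : A -> A -> zmodType ;
  pull : forall (Z Z' X : A), hom Z' Z -> ext Z X -> ext Z' X ;
  push : forall (Z X X' : A), hom X X' -> ext Z X -> ext Z X' ;
  realizes : forall (X Y Z : A), ext Z X -> hom X Y -> hom Y Z -> Prop ;
  pull1 : forall Z X (d : ext Z X), pull (idm Z) d = d ;
  pullM : forall Z Z' Z'' X (c : hom Z' Z) (c' : hom Z'' Z') (d : ext Z X),
    pull (c \oc c') d = pull c' (pull c d) ;
  pullDl : forall Z Z' X (c c' : hom Z' Z) (d : ext Z X),
    pull (c + c') d = pull c d + pull c' d ;
  pullDr : forall Z Z' X (c : hom Z' Z) (d d' : ext Z X),
    pull c (d + d') = pull c d + pull c d' ;
  push1 : forall Z X (d : ext Z X), push (idm X) d = d ;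
  pushM : forall Z X X' X'' (a' : hom X' X'') (a : hom X X') (d : ext Z X),
    push (a' \oc a) d = push a' (push a d) ;
  pushDl : forall Z X X' (a a' : hom X X') (d : ext Z X),
    push (a + a') d = push a d + push a' d ;
  pushDr : forall Z X X' (a : hom X X') (d d' : ext Z X),
    push a (d + d') = push a d + push a d' ;
  push_pull : forall Z Z' X X' (a : hom X X') (c : hom Z' Z) (d : ext Z X),
    push a (pull c d) = pull c (push a d) ;
  realizes_ex : forall Z X (d : ext Z X),
    exists Y (x : hom X Y) (y : hom Y Z), realizes d x y ;
  realizes_class : forall X Y Y' Z (d : ext Z X) (x : hom X Y) (y : hom Y Z)
      (x' : hom X Y') (y' : hom Y' Z),
    realizes d x y -> (realizes d x' y' <-> seq_equiv x y x' y') ;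
  realizes_mor : forall X Y Z X' Y' Z' (d : ext Z X) (d' : ext Z' X')
      (x : hom X Y) (y : hom Y Z) (x' : hom X' Y') (y' : hom Y' Z')
      (a : hom X X') (c : hom Z Z'),
    realizes d x y -> realizes d' x' y' -> push a d = pull c d' ->
    exists b : hom Y Y', b \oc x = x' \oc a /\ y' \oc b = c \oc y ;
  realizes0 : forall X Z S (iX : hom X S) (iZ : hom Z S) pX pZ,
    is_dsum2 iX iZ pX pZ -> realizes (0 : ext Z X) iX pZ ;
  realizes_dsum : forall X Y Z X' Y' Z' (d : ext Z X) (d' : ext Z' X')
      (x : hom X Y) (y : hom Y Z) (x' : hom X' Y') (y' : hom Y' Z')
      SX (iX : hom X SX) (iX' : hom X' SX) (pX : hom SX X) (pX' : hom SX X')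
      SY (iY : hom Y SY) (iY' : hom Y' SY) (pY : hom SY Y) (pY' : hom SY Y')
      SZ (iZ : hom Z SZ) (iZ' : hom Z' SZ) (pZ : hom SZ Z) (pZ' : hom SZ Z'),
    is_dsum2 iX iX' pX pX' -> is_dsum2 iY iY' pY pY' ->
    is_dsum2 iZ iZ' pZ pZ' ->
    realizes d x y -> realizes d' x' y' ->
    realizes (push iX (pull pZ d) + push iX' (pull pZ' d'))
      (iY \oc x \oc pX + iY' \oc x' \oc pX')
      (iZ \oc y \oc pY + iZ' \oc y' \oc pY') ;
  ET3 : forall X Y Z X' Y' Z' (d : ext Z X) (d' : ext Z' X')
      (x : hom X Y) (y : hom Y Z) (x' : hom X' Y') (y' : hom Y' Z')
      (a : hom X X') (b : hom Y Y'),
    realizes d x y -> realizes d' x' y' -> b \oc x = x' \oc a ->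
    exists c : hom Z Z', c \oc y = y' \oc b /\ push a d = pull c d' ;
  ET3op : forall X Y Z X' Y' Z' (d : ext Z X) (d' : ext Z' X')
      (x : hom X Y) (y : hom Y Z) (x' : hom X' Y') (y' : hom Y' Z')
      (b : hom Y Y') (c : hom Z Z'),
    realizes d x y -> realizes d' x' y' -> c \oc y = y' \oc b ->
    exists a : hom X X', b \oc x = x' \oc a /\ push a d = pull c d' ;
  ET4 : forall X Y Z D F (d : ext D X) (d' : ext F Y)
      (f : hom X Y) (f' : hom Y D) (g : hom Y Z) (g' : hom Z F),
    realizes d f f' -> realizes d' g g' ->
    exists E (h' : hom Z E) (u : hom D E) (e : hom E F) (d'' : ext E X),
      [/\ realizes d'' (g \oc f) h', h' \oc g = u \oc f' & e \oc h' = g'] /\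
      [/\ realizes (push f' d') u e, pull u d'' = d & push f d'' = pull e d'] ;
  ET4op : forall X Y Z D F (d : ext Y D) (d' : ext Z F)
      (f' : hom D X) (f : hom X Y) (g' : hom F Y) (g : hom Y Z),
    realizes d f' f -> realizes d' g' g ->
    exists E (h' : hom E X) (u : hom D E) (e : hom E F) (d'' : ext Z E),
      [/\ realizes d'' h' (g \oc f), f \oc h' = g' \oc e & h' \oc u = f'] /\
      [/\ realizes (pull g' d) u e, push e d'' = d' & push u d = pull g d''] }.

Record extriangulated := Extriangulated {
  extri_cat :> additive_cat ;
  extri_str : extriangulation extri_cat }.

Definition conflation (E : extriangulated) (X Y Z : E)
    (x : hom X Y) (y : hom Y Z) : Prop :=
  exists d : ext (extri_str E) Z X, realizes d x y.

Definition exact_functor (E E' : extriangulated) (F : functor E E') : Prop :=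
  additive_functor F /\
  forall X Y Z (x : hom X Y) (y : hom Y Z),
    conflation x y -> conflation (fmap F x) (fmap F y).

(* For a family of functors indexed by G, the identity T_g X -> T_h X along an
   equality g = h; it is needed because T_(g(hk)) X and T_((gh)k) X are equal
   but not convertible. *)
Definition gcast (A : preadditive_cat) (G : Type) (T : G -> functor A A) (g h : G)
    (e : g = h) (X : A) : hom (T g X) (T h X) :=
  match e with erefl => idm _ end.

Record cat_action (G : finGroupType) (E : extriangulated) := Action {
  act :> G -> functor E E ;
  act_exact : forall g, exact_functor (act g) ;
  act_equiv : forall g, is_equivalence (act g) ;
  gam : forall g h X, hom (act g (act h X)) (act (g * h)%g X) ;
  gam_iso : forall g h X, is_iso (gam g h X) ;
  gam_nat : forall g h X Y (f : hom X Y),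
    gam g h Y \oc fmap (act g) (fmap (act h) f) =
    fmap (act (g * h)%g) f \oc gam g h X ;
  gam_cocycle : forall g h k X,
    gcast act (mulgA g h k) X \oc gam g (h * k)%g X \oc
      fmap (act g) (gam h k X) =
    gam (g * h)%g k X \oc gam g h (act k X) }.

Arguments gam {G E} c g h X.

Section Equivariantization.
Variables (G : finGroupType) (E : extriangulated) (T : cat_action G E).

Record eqobj := EqObj {
  eobj : E ;
  ephi : forall g, hom (T g eobj) eobj ;
  ephi_iso : forall g, is_iso (ephi g) ;
  ephi_act : forall g h,
    ephi (g * h)%g \oc gam T g h eobj = ephi g \oc fmap (T g) (ephi h) }.

Definition equivariant (X Y : eqobj) (f : hom (eobj X) (eobj Y)) : bool :=
  `[< forall g, f \oc ephi X g = ephi Y g \oc fmap (T g) f >].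

Record eqhom (X Y : eqobj) := EqHom {
  ehom : hom (eobj X) (eobj Y) ;
  ehomP : ehom \in @equivariant X Y }.

Lemma ehomE X Y (f : eqhom X Y) g :
  ehom f \oc ephi X g = ephi Y g \oc fmap (T g) (ehom f).
Proof. by have /asboolP := ehomP f; apply. Qed.

Lemma mem_equivariant X Y (f : hom (eobj X) (eobj Y)) :
  (forall g, f \oc ephi X g = ephi Y g \oc fmap (T g) f) ->
  f \in @equivariant X Y.
Proof. by move=> h; apply/asboolP. Qed.

HB.instance Definition _ X Y := [isSub for @ehom X Y].
HB.instance Definition _ X Y := [Choice of eqhom X Y by <:].

Lemma actD g (X Y : E) (f f' : hom X Y) :
  fmap (T g) (f + f') = fmap (T g) f + fmap (T g) f'.
Proof. exact: (act_exact T g).1. Qed.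

Lemma act0 g (X Y : E) : fmap (T g) (0 : hom X Y) = 0.
Proof. by apply: (addrI (fmap (T g) 0)); rewrite -actD !addr0. Qed.

Lemma actN g (X Y : E) (f : hom X Y) : fmap (T g) (- f) = - fmap (T g) f.
Proof. by apply/eqP; rewrite -addr_eq0 -actD addNr act0. Qed.

Lemma act_sum g (X Y : E) (I : finType) (f : I -> hom X Y) :
  fmap (T g) (\sum_i f i) = \sum_i fmap (T g) (f i).
Proof. by apply: big_morph => [? ?|]; rewrite ?actD ?act0. Qed.

Lemma equivariant_zmod_closed X Y : zmod_closed (@equivariant X Y).
Proof.
split=> [|f f' /asboolP hf /asboolP hf']; apply: mem_equivariant => g.
  by rewrite comp0m act0 compm0.
by rewrite compDl compNl hf hf' actD actN compDr compNr.
Qed.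

HB.instance Definition _ X Y :=
  GRing.isZmodClosed.Build _ (@equivariant X Y) (@equivariant_zmod_closed X Y).
HB.instance Definition _ X Y :=
  [SubChoice_isSubZmodule of eqhom X Y by <:].

Program Definition eq_idm (X : eqobj) : eqhom X X := @EqHom X X (idm _) _.
Next Obligation.
by move=> X; apply: mem_equivariant => g; rewrite fmap1 comp1m compm1.
Qed.

Program Definition eq_comp (X Y Z : eqobj) (f : eqhom Y Z) (f' : eqhom X Y) :
  eqhom X Z := @EqHom X Z (ehom f \oc ehom f') _.
Next Obligation.
by move=> *; apply: mem_equivariant => g; rewrite -compA ehomE compA ehomE -compA fmapM.
Qed.

Program Definition equivariantization_preadditive : preadditive_cat :=
  @Preadditive eqobj (fun X Y => eqhom X Y) eq_idm eq_comp _ _ _ _ _.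
Next Obligation. by move=> *; apply: val_inj; rewrite /= comp1m. Qed.
Next Obligation. by move=> *; apply: val_inj; rewrite /= compm1. Qed.
Next Obligation. by move=> *; apply: val_inj; rewrite /= compA. Qed.
Next Obligation. by move=> *; apply: val_inj; rewrite /= compDl. Qed.
Next Obligation. by move=> *; apply: val_inj; rewrite /= compDr. Qed.

Section DirectSum.
Variables (I : finType) (X : I -> eqobj).
Let S := bigdsum (fun i => eobj (X i)).

Definition eqdsum_phi g : hom (T g S) S :=
  \sum_i inj S i \oc ephi (X i) g \oc fmap (T g) (prj S i).

Lemma eqdsum_phi_prj g i :
  prj S i \oc eqdsum_phi g = ephi (X i) g \oc fmap (T g) (prj S i).
Proof.
have [h1 h0 _] := dsumP S.
rewrite comp_sumr (bigD1 i) //= big1 ?addr0 => [|j ji].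
  by rewrite !compA h1 comp1m.
by rewrite !compA h0 // !comp0m.
Qed.

Lemma eqdsum_phi_inj g i :
  eqdsum_phi g \oc fmap (T g) (inj S i) = inj S i \oc ephi (X i) g.
Proof.
have [h1 h0 _] := dsumP S.
rewrite comp_suml (bigD1 i) //= big1 ?addr0 => [|j ji].
  by rewrite -!compA -fmapM h1 fmap1 compm1.
by rewrite -!compA -fmapM h0 1?eq_sym // act0 !compm0.
Qed.

Lemma eqdsum_phi_iso g : is_iso (eqdsum_phi g).
Proof.
pose q i := sval (cid (ephi_iso (X i) g)).
have qE i : q i \oc ephi (X i) g = idm _ /\ ephi (X i) g \oc q i = idm _.
  exact: (svalP (cid (ephi_iso (X i) g))).
have [_ _ hs] := dsumP S.
exists (\sum_i fmap (T g) (inj S i) \oc q i \oc prj S i); split.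
  rewrite comp_suml -[RHS]fmap1 -hs act_sum; apply: eq_bigr => i _.
  by rewrite -compA eqdsum_phi_prj compA -(compA _ (q i)) (qE i).1 compm1 fmapM.
rewrite comp_sumr -[RHS]hs; apply: eq_bigr => i _.
by rewrite !compA eqdsum_phi_inj -(compA _ _ (q i)) (qE i).2 compm1.
Qed.

Lemma eqdsum_phi_act g h :
  eqdsum_phi (g * h)%g \oc gam T g h S =
  eqdsum_phi g \oc fmap (T g) (eqdsum_phi h).
Proof.
rewrite /eqdsum_phi act_sum comp_suml comp_sumr; apply: eq_bigr => i _.
rewrite !fmapM !compA eqdsum_phi_inj -!compA; congr (_ \oc _).
by rewrite -gam_nat !compA ephi_act.
Qed.

Definition eqdsum_obj : eqobj := EqObj eqdsum_phi_iso eqdsum_phi_act.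

Program Definition eqdsum_inj i : eqhom (X i) eqdsum_obj :=
  @EqHom (X i) eqdsum_obj (inj S i) _.
Next Obligation.
by move=> i; apply: mem_equivariant => g; rewrite /= eqdsum_phi_inj.
Qed.

Program Definition eqdsum_prj i : eqhom eqdsum_obj (X i) :=
  @EqHom eqdsum_obj (X i) (prj S i) _.
Next Obligation.
by move=> i; apply: mem_equivariant => g; rewrite /= eqdsum_phi_prj.
Qed.

Lemma eqdsumP : @is_dsum equivariantization_preadditive I X eqdsum_obj eqdsum_inj eqdsum_prj.
Proof.
have [h1 h0 hs] := dsumP S.
split=> [i|i j ij|]; apply: val_inj => /=; [exact: h1|exact: h0|].
rewrite -[RHS]hs.
by apply: (big_morph (@ehom eqdsum_obj eqdsum_obj)).
Qed.

End DirectSum.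

Definition equivariantization : additive_cat :=
  @Additive equivariantization_preadditive
    (fun I X => squash (@Dsum equivariantization_preadditive I X _ _ _ (eqdsumP X))).

Definition forget : functor equivariantization E :=
  @Functor equivariantization E eobj (fun X Y f => ehom f) (fun _ => erefl)
    (fun _ _ _ _ _ => erefl).

Section Induction.
Variable A : E.
Let S := bigdsum (fun g => T g A).

(* The component of tau_h on the summand T_h T_(h^-1 g) A -> T_g A is
   gamma_(h, h^-1 g); the sum is reindexed by k = h^-1 g. *)
Definition ind_phi h : hom (T h S) S :=
  \sum_k inj S (h * k)%g \oc gam T h k A \oc fmap (T h) (prj S k).

Lemma ind_phi_prj h k :
  prj S (h * k)%g \oc ind_phi h = gam T h k A \oc fmap (T h) (prj S k).
Proof.
have [h1 h0 _] := dsumP S.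
rewrite comp_sumr (bigD1 k) //= big1 ?addr0 => [|j jk].
  by rewrite !compA h1 comp1m.
by rewrite !compA h0 ?comp0m // (inj_eq (mulgI h)).
Qed.

Lemma ind_phi_inj h k :
  ind_phi h \oc fmap (T h) (inj S k) = inj S (h * k)%g \oc gam T h k A.
Proof.
have [h1 h0 _] := dsumP S.
rewrite comp_suml (bigD1 k) //= big1 ?addr0 => [|j jk].
  by rewrite -!compA -fmapM h1 fmap1 compm1.
by rewrite -!compA -fmapM h0 1?eq_sym // act0 !compm0.
Qed.

Lemma ind_phi_iso h : is_iso (ind_phi h).
Proof.
pose q k := sval (cid (gam_iso T h k A)).
have qE k : q k \oc gam T h k A = idm _ /\ gam T h k A \oc q k = idm _.
  exact: (svalP (cid (gam_iso T h k A))).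
have [_ _ hs] := dsumP S.
exists (\sum_k fmap (T h) (inj S k) \oc q k \oc prj S (h * k)%g); split.
  rewrite comp_suml -[RHS]fmap1 -hs act_sum; apply: eq_bigr => k _.
  by rewrite -compA ind_phi_prj compA -(compA _ (q k)) (qE k).1 compm1 fmapM.
rewrite comp_sumr -[RHS]hs [RHS](reindex_inj (mulgI h)).
apply: eq_bigr => k _.
by rewrite !compA ind_phi_inj -(compA _ _ (q k)) (qE k).2 compm1.
Qed.

Lemma inj_gcast g h (e : g = h) : inj S h \oc gcast T e A = inj S g.
Proof. by case: _ / e; rewrite compm1. Qed.

Lemma ind_phi_act g h :
  ind_phi (g * h)%g \oc gam T g h S = ind_phi g \oc fmap (T g) (ind_phi h).
Proof.
rewrite [in LHS]/ind_phi [ind_phi h]/ind_phi act_sum comp_suml comp_sumr.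
apply: eq_bigr => k _.
rewrite !fmapM !compA ind_phi_inj -!compA -gam_nat !compA; congr (_ \oc _).
by rewrite -(inj_gcast (mulgA g h k)) -!compA -gam_cocycle !compA.
Qed.

Definition ind_obj : equivariantization := EqObj ind_phi_iso ind_phi_act.

End Induction.

Definition ind_mor (A B : E) (f : hom A B) :
    hom (eobj (ind_obj A)) (eobj (ind_obj B)) :=
  \sum_g inj (bigdsum (fun g => T g B)) g \oc fmap (T g) f \oc
         prj (bigdsum (fun g => T g A)) g.

Lemma ind_mor_prj (A B : E) (f : hom A B) g :
  prj (bigdsum (fun g => T g B)) g \oc ind_mor f =
  fmap (T g) f \oc prj (bigdsum (fun g => T g A)) g.
Proof.
have [h1 h0 _] := dsumP (bigdsum (fun g => T g B)).
rewrite comp_sumr (bigD1 g) //= big1 ?addr0 => [|j jk].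
  by rewrite !compA h1 comp1m.
by rewrite !compA h0 ?comp0m.
Qed.

Lemma ind_morP (A B : E) (f : hom A B) :
  ind_mor f \in @equivariant (ind_obj A) (ind_obj B).
Proof.
apply: mem_equivariant => h /=.
rewrite [in RHS]/ind_phi comp_suml {1}/ind_mor comp_suml.
rewrite (reindex_inj (mulgI h)); apply: eq_bigr => k _.
rewrite -[LHS]compA ind_phi_prj -!compA -fmapM ind_mor_prj fmapM.
by congr (_ \oc _); rewrite !compA gam_nat.
Qed.

Program Definition ind : functor E equivariantization :=
  @Functor E equivariantization ind_obj (fun A B f => EqHom (ind_morP f)) _ _.
Next Obligation.
move=> X; apply: val_inj => /=; have [_ _ hs] := dsumP (bigdsum (fun g => T g X)).
by rewrite -[RHS]hs; apply: eq_bigr => g _; rewrite fmap1 compm1.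
Qed.
Next Obligation.
move=> X Y Z g f; apply: val_inj => /=; rewrite [in RHS]/ind_mor comp_suml.
by apply: eq_bigr => k _; rewrite -[RHS]compA ind_mor_prj fmapM !compA.
Qed.

End Equivariantization.

Record asub (A : additive_cat) := Asub {
  asub_set :> A -> Prop ;
  asub_neq0 : exists X, asub_set X ;
  asub_dsum : forall (I : finType) (X : I -> A) (S : dsum X),
    (forall i, asub_set (X i)) -> asub_set S ;
  asub_summand : forall X S : A,
    direct_summand X S -> asub_set S -> asub_set X }.

Arguments asub_dsum {A} _ {I X} S _.

Lemma asub_dsum2 (A : additive_cat) (P : asub A) (X Y S : A)
    (iX : hom X S) (iY : hom Y S) (pX : hom S X) (pY : hom S Y) :
  is_dsum2 iX iY pX pY -> P S <-> P X /\ P Y.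
Proof.
move=> dS; split=> [PS|[PX PY]].
  split; apply: asub_summand PS; first by exists Y, iX, iY, pX, pY.
  by exists X, iY, iX, pY, pX; case: dS => *; split=> //; rewrite addrC.
by have /is_dsum2P dS' := dS; apply: (asub_dsum _ (Dsum dS')) => -[].
Qed.

Definition as_G (G : finGroupType) (E : extriangulated) (T : cat_action G E) :
    set (asub E) :=
  [set N | forall g X, N X -> N (T g X)].

Program Definition asubG (G : finGroupType) (E : extriangulated)
    (T : cat_action G E) (N : asub E) : asub (equivariantization T) :=
  @Asub (equivariantization T) [set X | N (eobj X)] _ _ _.
Next Obligation.
move=> G E T N; pose X (i : void) := of_void (eqobj T) i.
by exists (eqdsum_obj X); apply: asub_dsum; case.
Qed.
Next Obligation.
move=> G E T N I X S NX; have [h1 h0 hs] := dsumP S.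
have dS : @is_dsum E I (fun i => eobj (X i)) (eobj (dsum_obj S))
  (fun i => ehom (inj S i)) (fun i => ehom (prj S i)).
  split=> [i|i j ij|]; [by have /(congr1 val) := h1 i|
    by have /(congr1 val) := h0 i j ij|have /(congr1 val) /= <- := hs].
  by apply/esym; apply: (big_morph (@ehom _ _ _ _ _)).
exact: (asub_dsum N (Dsum dS)).
Qed.
Next Obligation.
move=> G E T N X S [Y [iX [iY [pX [pY [e1 e2 e3 e4 e5]]]]]].
apply: asub_summand.
exists (eobj Y), (ehom iX), (ehom iY), (ehom pX), (ehom pY).
split; [by have /(congr1 val) := e1|by have /(congr1 val) := e2|
  by have /(congr1 val) := e3|by have /(congr1 val) := e4|
  by have /(congr1 val) := e5].
Qed.

Definition supp (A : additive_cat) (C : set (asub A)) (X : A) : set (asub A) :=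
  [set P | C P /\ ~ P X].

Definition Esp (A : additive_cat) (C : set (asub A)) : Type := {P : asub A | P \in C}.

Definition Esp_val (A : additive_cat) (C : set (asub A)) (P : Esp C) : asub A := sval P.
Coercion Esp_val : Esp >-> asub.

Definition EspSub (A : additive_cat) (C : set (asub A)) (P : asub A) (CP : C P) : Esp C :=
  exist _ P (mem_set CP).

Section EspTopology.
Variables (A : additive_cat) (C : set (asub A)).

HB.instance Definition _ := gen_eqMixin (Esp C).
HB.instance Definition _ := gen_choiceMixin (Esp C).

Definition Esp_closed (U : set (Esp C)) : Prop :=
  exists X : set A, U = [set P : Esp C | asub_set P `&` X = set0].

Definition Esp_open (U : set (Esp C)) : Prop := Esp_closed (~` U).

Lemma Esp_openP (U : set (Esp C)) :
  Esp_open U <-> exists X : set A, U = [set P : Esp C | asub_set P `&` X !=set0].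
Proof.
split=> -[X e]; exists X.
  rewrite -[U]setCK e; apply/seteqP; split=> P /=.
    by move=> /eqP/set0P.
  by move=> /set0P/eqP.
rewrite e; apply/seteqP; split=> P /=.
  by move=> h; apply/eqP; apply: contrapT => /negP/set0P.
by move=> h /set0P/eqP.
Qed.

Lemma Esp_openT : Esp_open setT.
Proof.
apply/Esp_openP; exists setT; apply/seteqP; split=> // P _ /=.
by rewrite setIT; exact: asub_neq0.
Qed.

Lemma Esp_openI : setI_closed Esp_open.
Proof.
move=> U V /Esp_openP[X ->] /Esp_openP[Y ->]; apply/Esp_openP.
exists [set S | exists x y (ix : hom x S) (iy : hom y S)
  (px : hom S x) (py : hom S y), [/\ X x, Y y & is_dsum2 ix iy px py]].
apply/seteqP; split=> P /=.
  move=> [[x [Px Xx]] [y [Py Yy]]].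
  have [S [ix [iy [px [py dS]]]]] := dsum2_ex x y.
  exists S; split; first by apply/(asub_dsum2 P dS).
  by exists x, y, ix, iy, px, py.
move=> [S [PS [x [y [ix [iy [px [py [Xx Yy dS]]]]]]]]].
by have /(asub_dsum2 P dS)[Px Py] := PS; split; [exists x|exists y].
Qed.

Lemma Esp_open_bigcup (I : Type) (f : I -> set (Esp C)) :
  (forall i, Esp_open (f i)) -> Esp_open (\bigcup_i f i).
Proof.
move=> h; have {}h i : exists X : set A, f i = [set P : Esp C | asub_set P `&` X !=set0].
  by apply/Esp_openP.
apply/Esp_openP; exists (\bigcup_i sval (cid (h i))).
apply/seteqP; split=> P /=.
  move=> [i _]; rewrite (svalP (cid (h i))) => -[x [Px Xx]].
  by exists x; split=> //; exists i.
move=> [x [Px [i _ Xx]]]; exists i => //.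
by rewrite (svalP (cid (h i))); exists x.
Qed.

HB.instance Definition _ := isOpenTopological.Build (Esp C)
  Esp_openT Esp_openI Esp_open_bigcup.

Lemma closed_EspE (U : set (Esp C)) : closed U <-> Esp_closed U.
Proof. by rewrite -[in X in _ <-> X](setCK U) -openC. Qed.

End EspTopology.

Definition homeomorphism (X Y : topologicalType) (f : X -> Y) : Prop :=
  exists g : Y -> X, [/\ cancel f g, cancel g f, continuous f & continuous g].

(* [set_type (range f)] carries the subspace topology. *)
Definition corestrict (X Y : Type) (f : X -> Y) (x : X) : set_type (range f) :=
  exist _ (f x) (mem_set (imageT f x)).

Definition immersion (X Y : topologicalType) (f : X -> Y) : Prop :=
  homeomorphism (corestrict f).

Definition EspG (G : finGroupType) (E : extriangulated) (T : cat_action G E)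
    (C : set (asub E)) (P : Esp C) : Esp (asubG T @` C) :=
  EspSub (imageP (asubG T) (set_mem (svalP P))).

Definition Esp_incl (A : additive_cat) (C D : set (asub A)) (CD : C `<=` D)
    (P : Esp C) : Esp D :=
  EspSub (CD _ (set_mem (svalP P))).

(* Main.v *)
(** [Ind A] is the direct sum of the [T_g A], and [A] is isomorphic to [T_1 A],
    so a G-invariant [N] in as(E) contains [A] exactly when [N^G] contains
    [Ind A]. This gives (1), makes [N |-> N^G] injective, and shows that a test
    class [X] of objects of [E] can be traded for [Ind X], and a test class in
    [E^G] for its image under the forgetful functor, which is bicontinuity. The
    open sets of both Esp_(C^G) and Esp_D are cut out by the same test classes,
    so the inclusion is an immersion. *)

Require Import Defs.
From mathcomp Require Import all_boot fingroup ssralg.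
From mathcomp Require Import boolp classical_sets functions topology.

Set Implicit Arguments.
Unset Strict Implicit.
Unset Printing Implicit Defensive.

Import GRing.Theory.
Local Open Scope classical_set_scope.

Lemma is_iso_comp (A : preadditive_cat) (X Y Z : A) (g : hom Y Z) (f : hom X Y) :
  is_iso g -> is_iso f -> is_iso (g \oc f).
Proof.
move=> [g' [g'g gg']] [f' [f'f ff']]; exists (f' \oc g'); split.
  by rewrite Defs.compA -(Defs.compA f') g'g compm1.
by rewrite Defs.compA -(Defs.compA g) ff' compm1.
Qed.

Lemma is_iso_fmap (A B : preadditive_cat) (F : functor A B) (X Y : A)
    (f : hom X Y) :
  is_iso f -> is_iso (Defs.fmap F f).
Proof.
move=> [g [gf fg]]; exists (Defs.fmap F g).
by rewrite -!Defs.fmapM gf fg !Defs.fmap1.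
Qed.

Lemma is_iso_gcast (A : preadditive_cat) (G : Type) (T : G -> functor A A)
    (g h : G) (e : g = h) (X : A) :
  is_iso (gcast T e X).
Proof. by case: h / e => /=; exists (idm _); rewrite comp1m. Qed.

(** Closure under summands demands a complement, which a bare retraction lacks. Idempotent
    completeness provides it by splitting the complementary idempotent [idm S - i \oc p]. *)
Lemma asub_retract (A : additive_cat) (P : asub A) (X S : A)
    (i : hom X S) (p : hom S X) :
  idempotent_complete A -> p \oc i = idm X -> P S -> P X.
Proof.
move=> idemA pi; apply: asub_summand.
pose e := (idm S - i \oc p)%R.
have pe : p \oc e = 0%R.
  by rewrite compDr compNr compm1 Defs.compA pi comp1m subrr.
have ei : e \oc i = 0%R.
  by rewrite compDl compNl comp1m -Defs.compA pi compm1 subrr.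
have ee : e \oc e = e.
  by rewrite {1}/e compDl compNl comp1m -Defs.compA pe compm0 subr0.
have [Y [r [s [rs sr]]]] := idemA S e ee.
exists Y, i, s, p, r; split=> //.
(* Orthogonality holds because [s = e \oc s] and [r = r \oc e], while [p \oc e] and [e \oc i]
   vanish. *)
- by rewrite -[s]compm1 -rs (Defs.compA s) sr Defs.compA pe comp0m.
- by rewrite -[r]comp1m -rs -(Defs.compA r) sr -Defs.compA ei compm0.
- by rewrite sr addrC subrK.
Qed.

Lemma asub_inj (A : additive_cat) : injective (@asub_set A).
Proof.
move=> [P P0 Pd Ps] [Q Q0 Qd Qs] /= PQ; case: _ / PQ in Q0 Qd Qs *.
by congr Asub; exact: Prop_irrelevance.
Qed.

Section Invariant.
Variables (G : finGroupType) (E : extriangulated) (T : cat_action G E).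

(* [T_1 T_1 X] is isomorphic to [T_1 X] through gamma_(1,1); cancel one [T_1]. *)
Lemma act1_iso (X : E) : exists f : hom (T 1%g X) X, is_iso f.
Proof.
have [F' [[a [_ a_iso]] _]] := act_equiv T 1%g.
have [b [ab ba]] := a_iso (T 1%g X).
(* The composite runs [T 1 X -> F' (T 1 (T 1 X)) -> F' (T 1 X) -> X], with [F'] a quasi-inverse of
   [T 1]. *)
exists (a X \oc Defs.fmap F' (gcast T (mulg1 1%g) X \oc gam T 1%g 1%g X) \oc b).
apply: is_iso_comp; last by exists (a (T 1%g X)).
apply: is_iso_comp; first exact: a_iso.
by apply/is_iso_fmap/is_iso_comp; [exact: is_iso_gcast|exact: gam_iso].
Qed.

Lemma asubG_ind (N : asub E) (X : E) :
  idempotent_complete E -> as_G T N -> asubG T N (ind T X) <-> N X.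
Proof.
move=> idemE NG; split=> [NX|NX]; last by apply: (asub_dsum N) => g; exact: NG.
(* Two successive retractions: [X] is one of [T 1 X], which is one of the whole sum. *)
have [f [f' [_ ff']]] := act1_iso X; apply: (asub_retract idemE ff').
have [S1 _ _] := dsumP (bigdsum (fun g => T g X)).
exact: (asub_retract idemE (S1 1%g)).
Qed.

(** An invariant [N] is recovered from [asubG T N] as the class of those [X] whose induced object
    lies in it. *)
Lemma asubG_inj : idempotent_complete E -> {in as_G T &, injective (asubG T)}.
Proof.
move=> idemE M N /set_mem MG /set_mem NG MN; apply: asub_inj; apply/funext => X.
by apply/propext; rewrite -(asubG_ind X idemE MG) MN; exact: asubG_ind.
Qed.

End Invariant.

(** Stating openness through preimages avoids an explicit inverse, composes well, and lets the same
    condition serve for immersions. *)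
Lemma homeomorphismP (X Y : topologicalType) (f : X -> Y) :
  homeomorphism f <->
  [/\ injective f, forall y, exists x, f x = y, continuous f &
      forall U : set X, open U -> exists2 V : set Y, open V & U = f @^-1` V].
Proof.
split=> [[g [fK gK cf cg]]|[f_inj f_surj cf f_open]].
  split=> //; [exact: can_inj fK|by move=> y; exists (g y)|move=> U oU].
  exists (g @^-1` U); first by move/continuousP : cg; exact.
  by apply/seteqP; split=> x /=; rewrite fK.
pose g y := sval (cid (f_surj y)).
have gK : cancel g f by move=> y; exact: svalP (cid (f_surj y)).
exists g; split=> //; first by move=> x; apply: f_inj; rewrite gK.
apply/continuousP => U /f_open[V oV ->].
by rewrite (_ : g @^-1` _ = V) //; apply/seteqP; split=> y /=; rewrite gK.
Qed.

(** The corestriction is onto by construction, and the open sets of the range are the traces of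
    those of [Y]. *)
Lemma immersionP (X Y : topologicalType) (f : X -> Y) :
  injective f -> continuous f ->
  (forall U : set X, open U -> exists2 V : set Y, open V & U = f @^-1` V) ->
  immersion f.
Proof.
move=> f_inj cf f_open; apply/homeomorphismP; split.
- by move=> x y /(congr1 sval) /= /f_inj.
- move=> [y yf]; have [x _ fxy] := set_mem yf; exists x.
  exact: eq_exist.
- apply/continuousP => _ [V oV <-].
  by move/continuousP : cf => /(_ V oV).
- by move=> U /f_open[V oV ->]; exists (set_val @^-1` V) => //; exists V.
Qed.

Lemma Esp_inj (A : additive_cat) (C : set (asub A)) : injective (@Esp_val A C).
Proof. by move=> [P CP] [Q CQ] /= PQ; apply: eq_exist. Qed.

Lemma open_EspP (A : additive_cat) (C : set (asub A)) (U : set (Esp C)) :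
  open U <-> exists X : set A, U = [set P : Esp C | asub_set P `&` X !=set0].
Proof. exact: Esp_openP. Qed.

Lemma EspG_homeomorphism (G : finGroupType) (E : extriangulated)
    (T : cat_action G E) (C : set (asub E)) :
  idempotent_complete E -> C `<=` as_G T -> homeomorphism (@EspG G E T C).
Proof.
move=> idemE CG; apply/homeomorphismP; split.
- move=> [P CP] [Q CQ] /(congr1 sval) /= PQ; apply: eq_exist.
  by apply: (asubG_inj idemE) PQ; apply/mem_set/CG/set_mem.
- move=> [Q CQ]; have [P CP PQ] := set_mem CQ.
  by exists (EspSub CP); apply: eq_exist.
- apply/continuousP => _ /open_EspP[X ->]; apply/open_EspP.
  (* Membership in [asubG T P] only sees the underlying object, so the equivariant structure of the
     test objects can be forgotten. *)
  exists (@eobj G E T @` X); apply/seteqP; split=> P /= [Y].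
    by move=> [PY XY]; exists (eobj Y); split=> //; exists Y.
  by move=> [PY [Z XZ ZY]]; exists Z; split=> //=; rewrite ZY.
- move=> _ /open_EspP[X ->].
  exists [set Q : Esp (asubG T @` C) | asub_set Q `&` (ind T @` X) !=set0].
    by apply/open_EspP; exists (ind T @` X).
  have indP (P : Esp C) Y : asubG T P (ind T Y) <-> P Y.
    by apply: asubG_ind => //; apply/CG/set_mem/(svalP P).
  apply/seteqP; split=> P /= [Y].
    move=> [PY XY]; exists (ind T Y); split; last by exists Y.
    exact/indP.
  move=> [PY [Z XZ ZY]]; exists Z; split=> //.
  by apply/indP; move: PY; rewrite -ZY.
Qed.

Section Inclusion.
Variables (A : additive_cat) (C D : set (asub A)) (CD : C `<=` D).

Lemma Esp_incl_inj : injective (Esp_incl CD).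
Proof. by move=> P Q /(congr1 sval) PQ; apply: Esp_inj. Qed.

Lemma Esp_incl_continuous : continuous (Esp_incl CD).
Proof.
by apply/continuousP => _ /open_EspP[X ->]; apply/open_EspP; exists X.
Qed.

Lemma Esp_incl_open (U : set (Esp C)) :
  open U -> exists2 V : set (Esp D), open V & U = Esp_incl CD @^-1` V.
Proof.
move=> /open_EspP[X ->].
exists [set P : Esp D | asub_set P `&` X !=set0] => //.
by apply/open_EspP; exists X.
Qed.

Lemma Esp_incl_surj : (forall Q, exists P, Esp_incl CD P = Q) <-> D = C.
Proof.
split=> [surj|DC].
  apply/seteqP; split=> // Q DQ; have [[P CP]] := surj (EspSub DQ).
  by move=> /(congr1 sval) /= <-; exact: set_mem.
move=> [Q DQ]; have CQ : C Q by rewrite -DC; exact: set_mem.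
by exists (EspSub CQ); apply: eq_exist.
Qed.

End Inclusion.

Theorem theorem6p10 (G : finGroupType) (E : extriangulated) (T : cat_action G E)
    (idemE : idempotent_complete E)
    (strG : extriangulation (equivariantization T))
    (EG := Extriangulated strG)
    (exact_ind : @exact_functor E EG (ind T))
    (exact_forget : @exact_functor EG E (forget T))
    (adj_ind_forget : adjoint (ind T) (forget T))
    (adj_forget_ind : adjoint (forget T) (ind T))
    (summand_ind : forall X : equivariantization T,
       direct_summand X (ind T (forget T X)))
    (C : set (asub E)) (C_as_G : C `<=` as_G T)
    (CG := asubG T @` C) :
  [/\ (forall (X : E) (I : asub E), C I ->
         (supp C X I <-> supp CG (ind T X) (asubG T I))),
      (forall (X : equivariantization T) (I : asub E), C I ->
         (supp CG X (asubG T I) <-> supp C (forget T X) I))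
    & (forall (D : set (asub (equivariantization T))) (CGD : CG `<=` D),
         let toG : Esp C -> Esp CG := @EspG G E T C in
         let incl : Esp CG -> Esp D := @Esp_incl _ CG D CGD in
         [/\ homeomorphism toG, immersion incl, immersion (incl \o toG)
           & (homeomorphism (incl \o toG) <-> D = CG)])].
Proof.
have indP (X : E) I : C I -> asubG T I (ind T X) <-> I X.
  by move=> /C_as_G; exact: asubG_ind.
split=> [X I CI|X I CI|D CGD toG incl].
- split=> -[_ nIX]; split=> //; first by exists I.
    by move=> /(indP _ _ CI).
  by move=> /(indP _ _ CI).
(* Both non-memberships are the same proposition by definition of [asubG]. *)
- by split=> -[_ nIX]; split=> //; exists I.
have toG_homeo : homeomorphism toG by exact: EspG_homeomorphism.
have /homeomorphismP[toG_inj toG_surj ctoG toG_open] := toG_homeo.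
have inclG_inj : injective (incl \o toG).
  by move=> P Q /Esp_incl_inj/toG_inj.
have inclG_cont : continuous (incl \o toG).
  by move=> P; apply: continuous_comp; [exact: ctoG|exact: Esp_incl_continuous].
have inclG_open (U : set (Esp C)) :
    open U -> exists2 V : set (Esp D), open V & U = (incl \o toG) @^-1` V.
  move=> /toG_open[V /(Esp_incl_open CGD)[W oW ->] ->].
  by exists W.
split=> //.
- apply: immersionP; first exact: Esp_incl_inj.
    exact: Esp_incl_continuous.
  exact: Esp_incl_open.
- exact: immersionP.
(* Only surjectivity of the composite is still at stake; as [toG] is onto, it amounts to that of
   [incl]. *)
rewrite homeomorphismP -(Esp_incl_surj CGD); split.
  by move=> [_ surj _ _] Q; have [P] := surj Q; exists (toG P).
move=> surj; split=> // Q; have [P <-] := surj Q.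
by have [P' <-] := toG_surj P; exists P'.
Qed.
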